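(* Let $X$ be a Polish space, let $\mathscr{H}(K)$ be a reproducing kernel Hilbert space of Borel measurable functions $X\to\mathbb{F}$, let $\mu$ be a Borel probability measure on $X$, let $1<p<\infty$ and $\lambda>0$. Let $g:X\to\mathbb{F}$ and $c:\mathbb{F}\times\mathbb{F}\to\mathbb{R}^+=[0,\infty)$ be Borel measurable functions such that $c(0,g(\cdot))\in L^1(X,\mu)$ and, for every $z\in\mathbb{F}$, $c(\cdot,z)$ is lower semicontinuous and convex. Let $\hat f\in\mathscr{H}(K)$ be the unique optimizer of $$\inf_{f\in\mathscr{H}(K)} \int_X c(f(x),g(x))\,d\mu(x)+\lambda\|f\|_{\mathscr{H}(K)}^p .$$ Then $\hat f$ is in the closure (in $\mathscr{H}(K)$) of the linear span of $\{k_x\}_{x\in\operatorname{supp}(\mu)}$. Furthermore, if $\mu$ is finitely supported, or $\mathscr{H}(K)$ is finite-dimensional, then $\hat f$ is in the linear span of $\{k_x\}_{x\in\operatorname{supp}(\mu)}$.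
   Context: $\mathbb{F}=\mathbb{R}$ or $\mathbb{C}$. A reproducing kernel Hilbert space (RKHS) on $X$ is a vector subspace $\mathscr{H}$ of the space of all functions $X\to\mathbb{F}$ equipped with a Hilbert space inner product $\langle\cdot,\cdot\rangle$ ($\mathbb{F}$-linear in the first argument) such that each evaluation functional $f\mapsto f(x)$ is bounded. For $x\in X$, $k_x\in\mathscr{H}$ is the unique vector with $f(x)=\langle f,k_x\rangle$ for all $f\in\mathscr{H}$; the reproducing kernel is $K(y,x)=k_x(y)$, and $\mathscr{H}(K)$ denotes the RKHS with reproducing kernel $K$. Standing assumptions: $X$ is a Polish space, and all functions and measures are Borel measurable. Under the stated hypotheses on $c,g,p,\lambda$ the minimization problem has exactly one optimizer in $\mathscr{H}(K)$. *)

(* Defs.v *)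
From HB Require Import structures.
From mathcomp Require Import all_boot all_order all_algebra.
From mathcomp Require Import complex.
From mathcomp Require Import all_classical all_reals all_analysis.

Set Implicit Arguments.
Unset Strict Implicit.
Unset Printing Implicit Defensive.

Import Order.TTheory GRing.Theory Num.Theory.
Import numFieldNormedType.Exports.

Local Open Scope classical_set_scope.
Local Open Scope ring_scope.

Variant scalar_kind := RealScalars | ComplexScalars.

(* The norm of a numFieldType is valued in the field itself, so real numbers
   and scalars are related through [ofreal] and [repart] below. *)
Definition scalar_field (R : realType) (s : scalar_kind) : numFieldType :=
  match s with
  | RealScalars => R
  | ComplexScalars => R[i]
  end.

Definition conjugate (R : realType) (s : scalar_kind) :
    scalar_field R s -> scalar_field R s :=
  match s with
  | RealScalars => fun z => z
  | ComplexScalars => fun z => conjc z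
  end.

Definition ofreal (R : realType) (s : scalar_kind) : R -> scalar_field R s :=
  match s with
  | RealScalars => fun t => t
  | ComplexScalars => fun t => (t%:C)%C
  end.

Definition repart (R : realType) (s : scalar_kind) : scalar_field R s -> R :=
  match s with
  | RealScalars => fun z => z
  | ComplexScalars => fun z => complex.Re z
  end.

(* [g_sigma_algebraType] requires a pointed space; this is no restriction on a
   space that carries a probability measure. *)
Notation borel T := (g_sigma_algebraType (@open T)).

HB.instance Definition _ (S T : ptopologicalType) := Pointed.on (S * T)%type.

Definition borel_fun (S T : ptopologicalType) (f : S -> T) : Prop :=
  measurable_fun [set: borel S] (f : borel S -> borel T).

Definition metric_on (R : realType) (X : Type) (d : X -> X -> R) : Prop :=
  [/\ forall x y, 0 <= d x y,
      forall x y, d x y = 0 <-> x = y,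
      forall x y, d x y = d y x
    & forall x y z, d x z <= d x y + d y z].

Definition metric_induces_topology (R : realType) (X : topologicalType)
    (d : X -> X -> R) : Prop :=
  forall (x : X) (A : set X),
    nbhs x A <-> exists2 e : R, 0 < e & [set y | d x y < e] `<=` A.

Definition metric_complete (R : realType) (X : Type) (d : X -> X -> R) : Prop :=
  forall u : nat -> X,
    (forall e : R, 0 < e ->
       exists N, forall m n, (N <= m)%N -> (N <= n)%N -> d (u m) (u n) < e) ->
    exists x : X, d (u n) x @[n --> \oo] --> (0 : R).

Definition polish (R : realType) (X : topologicalType) : Prop :=
  (exists2 D : set X, countable D & dense D) /\
  (exists d : X -> X -> R,
     [/\ metric_on d, metric_induces_topology d & metric_complete d]).

Definition measure_support (R : realType) (X : ptopologicalType)
    (mu : {measure set (borel X) -> \bar R}) : set X :=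
  [set x | forall U : set X, open U -> U x -> (0 < mu U)%E].

Definition lin_span (K : pzRingType) (V : lmodType K) (A : set V) : set V :=
  [set v | exists n (a : 'I_n -> K) (w : 'I_n -> V),
     (forall i, A (w i)) /\ v = \sum_(i < n) a i *: w i].

(* The inner product takes arbitrary functions; only its values on [carrier]
   are constrained, and only those are ever used. *)
Record rkhs (R : realType) (s : scalar_kind) (X : Type) := RKHS {
  carrier : set (X -> scalar_field R s) ;
  dot : (X -> scalar_field R s) -> (X -> scalar_field R s) -> scalar_field R s ;
  carrier0 : carrier 0 ;
  carrier_linear : forall a f g,
    carrier f -> carrier g -> carrier (a *: f + g) ;
  dot_linear : forall a f g h, carrier f -> carrier g -> carrier h ->
    dot (a *: f + g) h = a * dot f h + dot g h ;
  dot_conj : forall f g, carrier f -> carrier g ->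
    dot g f = conjugate (dot f g) ;
  dot_ge0 : forall f, carrier f -> 0 <= dot f f ;
  dot_eq0 : forall f, carrier f -> dot f f = 0 -> f = 0 ;
  rkhs_complete : forall u : nat -> X -> scalar_field R s,
    (forall n, carrier (u n)) ->
    (forall e : R, 0 < e ->
       exists N, forall m n, (N <= m)%N -> (N <= n)%N ->
         Num.sqrt (repart (dot (u m - u n) (u m - u n))) < e) ->
    exists2 f, carrier f &
      Num.sqrt (repart (dot (u n - f) (u n - f))) @[n --> \oo] --> (0 : R) ;
  evaluation_bounded : forall x : X, exists M : R, forall f, carrier f ->
    `|f x| <= ofreal s (M * Num.sqrt (repart (dot f f)))
}.

Section RKHS_theory.
Context (R : realType) (s : scalar_kind) (X : Type) (H : rkhs R s X).

Definition rkhs_norm (f : X -> scalar_field R s) : R :=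
  Num.sqrt (repart (dot H f f)).

(* By the Riesz representation theorem exactly one function satisfies the
   condition below, so the default value of [xget] is never returned. *)
Definition kernel_at (x : X) : X -> scalar_field R s :=
  xget 0 [set k | carrier H k /\ forall f, carrier H f -> f x = dot H f k].

Definition rkhs_closure (A : set (X -> scalar_field R s)) :
    set (X -> scalar_field R s) :=
  [set f | carrier H f /\
    forall e : R, 0 < e -> exists2 g, A g & rkhs_norm (f - g) < e].

Definition finite_dimensional : Prop :=
  exists B : set (X -> scalar_field R s),
    [/\ finite_set B, B `<=` carrier H & carrier H `<=` lin_span B].

End RKHS_theory.

Definition convex_on_scalars (R : realType) (s : scalar_kind)
    (h : scalar_field R s -> R) : Prop :=
  forall (t : R) (v w : scalar_field R s), 0 <= t <= 1 ->
    h (ofreal s t * v + ofreal s (1 - t) * w) <= t * h v + (1 - t) * h w.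

Definition objective (R : realType) (s : scalar_kind) (X : ptopologicalType)
    (H : rkhs R s X) (mu : {measure set (borel X) -> \bar R}) (p lambda : R)
    (g : X -> scalar_field R s) (c : scalar_field R s * scalar_field R s -> R)
    (f : X -> scalar_field R s) : \bar R :=
  (\int[mu]_(x in [set: borel X]) (c (f x, g x))%:E
   + (lambda * rkhs_norm H f `^ p)%:E)%E.

(* There is exactly one optimizer under the assumptions of the theorem, so
   [optimizer] needs no separate uniqueness clause. *)
Definition optimizer (R : realType) (s : scalar_kind) (X : ptopologicalType)
    (H : rkhs R s X) (mu : {measure set (borel X) -> \bar R}) (p lambda : R)
    (g : X -> scalar_field R s) (c : scalar_field R s * scalar_field R s -> R)
    (f : X -> scalar_field R s) : Prop :=
  carrier H f /\
  forall h, carrier H h ->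
    (objective H mu p lambda g c f <= objective H mu p lambda g c h)%E.

(* Main.v *)
(* Let M be the linear span of the kernels k_x, x in supp mu, and let q be the
   orthogonal projection of fhat onto the closure of M.  Since fhat - q is
   orthogonal to every such k_x, the functions fhat and q agree on supp mu, whose
   complement is null because X is second countable; hence they have the same
   integral cost.  As |fhat|^2 = |q|^2 + |fhat - q|^2 and t |-> t^p is strictly
   increasing, optimality of fhat forces fhat = q.  When mu is finitely supported
   or the space is finite-dimensional, M lies in a finite-dimensional space, so
   the projection can be taken in M itself. *)

Require Import Defs.
From HB Require Import structures.
From mathcomp Require Import all_boot all_order all_algebra.
From mathcomp Require Import complex.
From mathcomp Require Import all_classical all_reals all_analysis.
From mathcomp Require Import ring lra.
Import Order.TTheory GRing.Theory Num.Theory.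
Import numFieldNormedType.Exports.
Local Open Scope classical_set_scope.
Local Open Scope ring_scope.
Set Implicit Arguments.
Unset Strict Implicit.
Unset Printing Implicit Defensive.

(** * Scalars: conjugation, real parts and order, uniformly over both fields *)

Section scalars.
Context (R : realType) (s : scalar_kind).
Local Notation F := (scalar_field R s).
Local Notation conj := (@conjugate R s).
Local Notation re := (@repart R s).
Local Notation real := (@ofreal R s).

Lemma conjugateD (a b : F) : conj (a + b) = conj a + conj b.
Proof. by case: s a b => //= a b; exact: raddfD. Qed.

Lemma conjugateM (a b : F) : conj (a * b) = conj a * conj b.
Proof. by case: s a b => //= a b; exact: rmorphM. Qed.

Lemma conjugateK (a : F) : conj (conj a) = a.
Proof. by case: s a => //= a; exact: conjcK. Qed.

Lemma conjugate0 : conj 0 = 0.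
Proof. by case: s => //=; exact: conjc0. Qed.

Lemma repartD (a b : F) : re (a + b) = re a + re b.
Proof. by case: s a b => //= -[a1 a2] [b1 b2]. Qed.

Lemma repart0 : re 0 = 0.
Proof. by case: s. Qed.

Lemma repart_conjugate (a : F) : re (conj a) = re a.
Proof. by case: s a => //= -[]. Qed.

Lemma repart_ofrealM (t : R) (a : F) : re (real t * a) = t * re a.
Proof. by case: s a => //= -[a1 a2] /=; rewrite mul0r subr0. Qed.

Lemma repart_ge0 (a : F) : 0 <= a -> 0 <= re a.
Proof. by case: s a => //= a; rewrite lecE => /andP[]. Qed.

Lemma ge0_repart_eq0 (a : F) : 0 <= a -> re a = 0 -> a = 0.
Proof.
case: s a => //= -[a1 a2]; rewrite lecE /= => /andP[/eqP -> _] -> //.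
Qed.

(** The product is the squared modulus, hence a sum of two real squares in the complex case. This is
    what upgrades orthogonality of real parts to orthogonality over [F]. *)
Lemma repart_conjugateM_eq0 (a : F) : re (conj a * a) = 0 -> a = 0.
Proof.
case: s a => /= [a /eqP|[a1 a2] /= h]; first by rewrite mulf_eq0 orbb => /eqP.
have h2 : a1 ^+ 2 + a2 ^+ 2 = 0 by rewrite -h; ring.
have/andP[/eqP a1_0 /eqP a2_0] : (a1 == 0) && (a2 == 0).
  rewrite -(sqrf_eq0 a1) -(sqrf_eq0 a2) -paddr_eq0 ?sqr_ge0//.
  by rewrite h2.
by rewrite a1_0 a2_0.
Qed.

Lemma normr_le_ofreal_eq0 (a : F) :
  (forall e : R, 0 < e -> `|a| <= real e) -> a = 0.
Proof.
move=> h; apply/eqP; rewrite -normr_le0; move: h.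
case: s a => /= a h.
  by apply/ler_addgt0Pl => e e0; rewrite addr0; exact: h.
have le0 : complex.Re `|a| <= 0.
  apply/ler_addgt0Pl => e e0; rewrite addr0; move: (h e e0).
  by rewrite lecE => /andP[].
have : 0 <= `|a| by [].
by rewrite !lecE /= => /andP[/eqP -> _]; rewrite eqxx.
Qed.

Lemma ofreal1 : real 1 = 1.
Proof. by case: s. Qed.

Lemma ofrealN (t : R) : real (- t) = - real t.
Proof. by case: s => //=; exact: raddfN. Qed.

Lemma ler_ofreal (t u : R) : (real t <= real u) = (t <= u).
Proof. by case: s => //=; exact: lecR. Qed.

End scalars.

(** * Inner-product geometry of the Hilbert space *)

Section inner_product.
Context (R : realType) (s : scalar_kind) (X : Type) (H : rkhs R s X).
Local Notation F := (scalar_field R s).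
Local Notation E := (X -> F).
Local Notation carrier := (carrier H).
Local Notation dot := (dot H).
Implicit Types (f g h u v w : E) (M : set E).

Definition subspace M :=
  [/\ M `<=` carrier, M 0 & forall a f g, M f -> M g -> M (a *: f + g)].

Lemma subspace_carrier : subspace carrier.
Proof. by split => //; [exact: carrier0|exact: carrier_linear]. Qed.

Lemma subspaceD M f g : subspace M -> M f -> M g -> M (f + g).
Proof. by move=> [_ _ Ml] Mf Mg; rewrite -[f]scale1r; exact: Ml. Qed.

Lemma subspaceZ M a f : subspace M -> M f -> M (a *: f).
Proof. by move=> [_ M0 Ml] Mf; rewrite -[_ *: _]addr0; exact: Ml. Qed.

Lemma subspaceN M f : subspace M -> M f -> M (- f).
Proof. by move=> sM Mf; rewrite -scaleN1r; exact: subspaceZ. Qed.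

Lemma subspaceB M f g : subspace M -> M f -> M g -> M (f - g).
Proof. by move=> sM Mf Mg; apply: subspaceD => //; exact: subspaceN. Qed.

Lemma subspace_sum M (I : Type) (r : seq I) (G : I -> E) :
  subspace M -> (forall i, M (G i)) -> M (\sum_(i <- r) G i).
Proof.
move=> sM MG; elim/big_ind: _ => //; first by case: sM.
by move=> f g; exact: subspaceD.
Qed.

Let cD f g : carrier f -> carrier g -> carrier (f + g).
Proof. exact: (subspaceD subspace_carrier). Qed.

Let cB f g : carrier f -> carrier g -> carrier (f - g).
Proof. exact: (subspaceB subspace_carrier). Qed.

Let cZ a f : carrier f -> carrier (a *: f).
Proof. exact: (subspaceZ _ subspace_carrier). Qed.

Let c0 : carrier 0. Proof. exact: carrier0. Qed.

Lemma dotDl f g h : carrier f -> carrier g -> carrier h ->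
  dot (f + g) h = dot f h + dot g h.
Proof.
by move=> cf cg ch; rewrite -[f in LHS]scale1r dot_linear// mul1r.
Qed.

Lemma dot0l h : carrier h -> dot 0 h = 0.
Proof.
move=> ch; have := dotDl c0 c0 ch; rewrite addr0 => /eqP.
by rewrite -subr_eq0 opprD addNKr oppr_eq0 => /eqP.
Qed.

Lemma dotZl a f h : carrier f -> carrier h -> dot (a *: f) h = a * dot f h.
Proof.
by move=> cf ch; rewrite -[_ *: _]addr0 dot_linear// dot0l// addr0.
Qed.

Lemma dotBl f g h : carrier f -> carrier g -> carrier h ->
  dot (f - g) h = dot f h - dot g h.
Proof.
by move=> cf cg ch; rewrite -scaleN1r dotDl ?dotZl// ?mulN1r//; exact: cZ.
Qed.

Lemma dotZr a f h : carrier f -> carrier h ->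
  dot h (a *: f) = conjugate a * dot h f.
Proof.
move=> cf ch; rewrite dot_conj//; last exact: cZ.
by rewrite dotZl// conjugateM -dot_conj.
Qed.

Lemma dot_suml (I : Type) (r : seq I) (G : I -> E) h :
  (forall i, carrier (G i)) -> carrier h ->
  dot (\sum_(i <- r) G i) h = \sum_(i <- r) dot (G i) h.
Proof.
move=> cG ch; elim: r => [|i r IH]; first by rewrite !big_nil dot0l.
rewrite !big_cons dotDl ?IH//.
exact: subspace_sum subspace_carrier cG.
Qed.

(** The underlying real inner product induces the same norm, so distance estimates and the
    Cauchy-Schwarz inequality can be carried out over [R] for both scalar fields. *)
Definition rdot f g : R := repart (dot f g).

Lemma rdotC f g : carrier f -> carrier g -> rdot f g = rdot g f.
Proof. by move=> cf cg; rewrite /rdot dot_conj// repart_conjugate. Qed.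

Lemma rdotDl f g h : carrier f -> carrier g -> carrier h ->
  rdot (f + g) h = rdot f h + rdot g h.
Proof. by move=> *; rewrite /rdot dotDl// repartD. Qed.

Lemma rdotZl (t : R) f h : carrier f -> carrier h ->
  rdot (ofreal s t *: f) h = t * rdot f h.
Proof. by move=> *; rewrite /rdot dotZl// repart_ofrealM. Qed.

Lemma rdotBl f g h : carrier f -> carrier g -> carrier h ->
  rdot (f - g) h = rdot f h - rdot g h.
Proof.
move=> cf cg ch; rewrite -[- rdot g h]mulN1r -rdotZl// -rdotDl//; last exact: cZ.
by rewrite ofrealN ofreal1 scaleN1r.
Qed.

Lemma rdotBr f g h : carrier f -> carrier g -> carrier h ->
  rdot h (f - g) = rdot h f - rdot h g.
Proof.
move=> cf cg ch; rewrite rdotC//; last exact: cB.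
by rewrite rdotBl// !(rdotC ch).
Qed.

Lemma rdot_ge0 f : carrier f -> 0 <= rdot f f.
Proof. by move=> cf; apply/repart_ge0/dot_ge0. Qed.

Lemma rdot_eq0 f : carrier f -> rdot f f = 0 -> f = 0.
Proof.
by move=> cf f0; exact/(dot_eq0 cf)/ge0_repart_eq0/f0/dot_ge0.
Qed.

Lemma rdotDZ (t : R) f g : carrier f -> carrier g ->
  rdot (f + ofreal s t *: g) (f + ofreal s t *: g) =
  rdot f f + t * rdot f g *+ 2 + t ^+ 2 * rdot g g.
Proof.
move=> cf cg.
have cZg : carrier (ofreal s t *: g) by exact: cZ.
have cfg : carrier (f + ofreal s t *: g) by exact: cD.
rewrite rdotDl// rdotZl// (rdotC cf)// (rdotC cg)// !rdotDl// !rdotZl//.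
by rewrite (rdotC cg)//; ring.
Qed.

Lemma rdot_Pythagoras f g : carrier f -> carrier g -> rdot f g = 0 ->
  rdot (f + g) (f + g) = rdot f f + rdot g g.
Proof.
move=> cf cg fg; have := rdotDZ 1 cf cg.
by rewrite ofreal1 scale1r fg mulr0 mul0rn addr0 expr1n mul1r.
Qed.

Lemma rdotBB f g : carrier f -> carrier g -> rdot (f - g) (f - g) =
  rdot (g - f) (g - f).
Proof.
move=> cf cg; rewrite !(rdotBl, rdotBr)//; [|exact: cB..].
ring.
Qed.

Lemma rdot_CauchySchwarz f g : carrier f -> carrier g ->
  rdot f g ^+ 2 <= rdot f f * rdot g g.
Proof.
move=> cf cg; have [/eqP g0|g0] := eqVneq (rdot g g) 0.
  move/eqP : g0 => /(rdot_eq0 cg) ->.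
  by rewrite rdotC// /rdot !dot0l// repart0 expr0n/= mulr0.
have gg0 : 0 < rdot g g by rewrite lt_neqAle eq_sym g0 rdot_ge0.
(* The coefficient minimizes the quadratic [rdotDZ] in [t]; nonnegativity of the minimum is the
   inequality after multiplication by [rdot g g]. *)
have : 0 <= rdot (f + ofreal s (- (rdot f g / rdot g g)) *: g)
                 (f + ofreal s (- (rdot f g / rdot g g)) *: g).
  by apply/rdot_ge0/cD => //; exact: cZ.
rewrite rdotDZ// => h; rewrite -subr_ge0.
have -> : rdot f f * rdot g g - rdot f g ^+ 2 = rdot g g *
  (rdot f f + - (rdot f g / rdot g g) * rdot f g *+ 2 +
    (- (rdot f g / rdot g g)) ^+ 2 * rdot g g) by field.
by rewrite mulr_ge0// ltW.
Qed.

(** With [a = dot f v], the vector [a *: v] is again in [M], and its inner product with [f] is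
    [conjugate a * a]. *)
Lemma rdot_subspace_eq0 M f : subspace M -> carrier f ->
  (forall v, M v -> rdot f v = 0) -> forall v, M v -> dot f v = 0.
Proof.
move=> sM cf h v Mv; have [Mc _ _] := sM.
apply/repart_conjugateM_eq0.
by rewrite -dotZr//; [exact: h (subspaceZ _ sM Mv)|exact: Mc].
Qed.

Lemma rkhs_norm_lt f (e : R) : carrier f -> 0 < e ->
  (rkhs_norm H f < e) = (rdot f f < e ^+ 2).
Proof.
move=> cf e0; rewrite -[e in LHS]ger0_norm ?ltW// -sqrtr_sqr.
by rewrite ltr_sqrt// exprn_gt0.
Qed.

End inner_product.

(** * Orthogonal projection onto a closure, and existence of the kernels *)

Section projection.
Context (R : realType) (s : scalar_kind) (X : Type) (H : rkhs R s X).
Local Notation F := (scalar_field R s).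
Local Notation E := (X -> F).
Local Notation carrier := (carrier H).
Local Notation dot := (dot H).
Local Notation rdot := (rdot H).
Implicit Types (f g h u v w : E) (M : set E).

Let cB f g : carrier f -> carrier g -> carrier (f - g).
Proof. exact: (subspaceB (subspace_carrier H)). Qed.

(** Quantitative first variation: if [v] is within [e] of minimizing the squared distance to [f],
    then its residual is orthogonal to [M] up to an error that vanishes with [e]. *)
Lemma almost_minimizer_rdot M (d e : R) f v u : subspace H M -> carrier f ->
  (forall w, M w -> d <= rdot (f - w) (f - w)) ->
  M v -> rdot (f - v) (f - v) <= d + e -> M u ->
  rdot (f - v) u ^+ 2 <= rdot u u * e.
Proof.
move=> sM cf dmin Mv ve Mu; have [Mc _ _] := sM.
have cfv : carrier (f - v) by apply: cB => //; exact: Mc.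
have cu : carrier u by exact: Mc.
have [u0|u0] := eqVneq (rdot u u) 0.
  by have := rdot_CauchySchwarz cfv cu; rewrite u0 mulr0 mul0r.
have uu0 : 0 < rdot u u by rewrite lt_neqAle eq_sym u0 rdot_ge0.
(* Compare [v] with its translate along [u] that minimizes the distance to [f]. *)
set b := rdot (f - v) u; set c := rdot u u.
have := dmin (v - ofreal s (- (b / c)) *: u).
rewrite opprB addrCA [_ + (f - v)]addrC rdotDZ// -/b -/c => h.
have {}h := le_trans (h (subspaceB sM Mv (subspaceZ _ sM Mu))) _.
have {}h : d <= d + e + - (b / c) * b *+ 2 + (- (b / c)) ^+ 2 * c.
  by apply: h; rewrite !lerD2r.
have -> : b ^+ 2 = c * e - c * (e + - (b / c) * b *+ 2 + (- (b / c)) ^+ 2 * c).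
  by field.
rewrite gerBl; apply: mulr_ge0; [exact: ltW|lra].
Qed.

(** A minimizing sequence [v] in [M] has almost orthogonal residuals. This forces it to be Cauchy,
    and exact orthogonality survives in the limit [q]. *)
Lemma projection_closure M f : subspace H M -> carrier f ->
  exists2 q, rkhs_closure H M q & forall v, M v -> dot (f - q) v = 0.
Proof.
move=> sM cf; have [Mc M0 Ml] := sM.
pose D := [set rdot (f - w) (f - w) | w in M]; pose d := inf D.
have D0 : lbound D 0.
  by move=> _ [w Mw <-]; apply: rdot_ge0; apply: cB => //; exact: Mc.
have Dinf : has_inf D.
  by split; [exists (rdot (f - 0) (f - 0)), 0|exists 0].
have dmin w : M w -> d <= rdot (f - w) (f - w).
  by move=> Mw; apply: ge_inf; [exists 0|exists w].
have /choice[v vP] (n : nat) :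
    exists v, M v /\ rdot (f - v) (f - v) <= d + n.+1%:R^-1.
  have n0 : 0 < n.+1%:R^-1 :> R by rewrite invr_gt0.
  have [_ [w Mw <-] wn] := inf_adherent n0 Dinf.
  by exists w; split => //; exact: ltW.
have Mv n : M (v n) by have [] := vP n.
have cv n : carrier (v n) by exact: Mc.
have key n u : M u -> rdot (f - v n) u ^+ 2 <= rdot u u * n.+1%:R^-1.
  exact: almost_minimizer_rdot sM cf dmin (Mv n) (vP n).2.
have sqrD (x y : R) : (x + y) ^+ 2 <= (x ^+ 2 + y ^+ 2) *+ 2.
  by have := sqr_ge0 (x - y); nra.
(* The difference [u] of two terms is also a difference of two residuals. Testing both residuals
   against [u] itself bounds the square of [rdot u u] by [rdot u u] times the right-hand side, and
   one factor cancels. *)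
have vdist m n : rdot (v m - v n) (v m - v n) <=
    (n.+1%:R^-1 + m.+1%:R^-1) *+ 2.
  set u := v m - v n.
  have Mu : M u by exact: (subspaceB sM).
  have cu := Mc _ Mu.
  have uE : rdot u u = rdot (f - v n) u + - rdot (f - v m) u.
    rewrite -rdotBl//; [|exact: cB..].
    by congr (rdot _ u); rewrite opprB addrCA addrAC subrr sub0r.
  have := sqrD (rdot (f - v n) u) (- rdot (f - v m) u).
  rewrite -uE sqrrN; have := key n u Mu; have := key m u Mu.
  have [->|u0] := eqVneq (rdot u u) 0.
    by move=> *; rewrite mulrn_wge0// addr_ge0// invr_ge0.
  have uu0 : 0 < rdot u u by rewrite lt_neqAle eq_sym u0 rdot_ge0.
  move=> h1 h2 h3; rewrite -(ler_pM2l uu0) -expr2 (le_trans h3)//.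
  by rewrite mulrnAr ler_wMn2r// mulrDr lerD.
have small (e : R) : 0 < e -> exists N, forall n, (N <= n)%N -> n.+1%:R^-1 < e.
  move=> e0; have /cvgrPdist_lt/(_ _ e0)[N _ NP] := @cvg_harmonic R.
  exists N => n Nn; have := NP n Nn.
  by rewrite /= sub0r normrN ger0_norm ?invr_ge0.
have [q cq qlim] : exists2 q, carrier q &
    Num.sqrt (repart (dot (v n - q) (v n - q))) @[n --> \oo] --> (0 : R).
  apply: rkhs_complete => // e e0.
  have e4 : 0 < e ^+ 2 / 4 by rewrite divr_gt0// exprn_gt0.
  have [N NP] := small _ e4.
  exists N => m n Nm Nn.
  rewrite -[X in X < _]/(rkhs_norm H _) rkhs_norm_lt//; last exact: cB.
  apply: le_lt_trans (vdist m n) _.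
  by move: (NP m Nm) (NP n Nn); move: m.+1%:R^-1 n.+1%:R^-1 => a b; lra.
have {}qlim (e : R) : 0 < e ->
    exists N, forall n, (N <= n)%N -> rdot (v n - q) (v n - q) < e ^+ 2.
  move=> e0; have /cvgrPdist_lt/(_ _ e0)[N _ NP] := qlim.
  exists N => n Nn; have := NP n Nn.
  rewrite /= sub0r normrN ger0_norm ?sqrtr_ge0//.
  by rewrite -[X in X < _]/(rkhs_norm H _) rkhs_norm_lt//; exact: cB.
exists q.
  split=> // e e0; have [N NP] := qlim e e0.
  exists (v N) => //; rewrite rkhs_norm_lt//; last exact: cB.
  by rewrite rdotBB//; exact: NP.
apply: rdot_subspace_eq0 => // [|u Mu]; first exact: cB.
have cu := Mc _ Mu.
apply/eqP; rewrite -sqrf_eq0 eq_le sqr_ge0 andbT.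
apply/ler_addgt0Pl => e e0; rewrite addr0.
(* Adding 1 allows division by [c] even when [u] is zero. Split [f - q] at [v n]: each part
   contributes a square of at most [e / 4], and [sqrD] doubles their sum, giving [e]. *)
pose c := rdot u u + 1; have c0 : 0 < c by rewrite ltr_wpDl// rdot_ge0.
have e'0 : 0 < e / c / 4 by rewrite !divr_gt0.
have [N1 NP1] := small _ e'0.
have e''0 : 0 < Num.sqrt (e / c / 4) by rewrite sqrtr_gt0.
have [N2 NP2] := qlim _ e''0.
pose n := maxn N1 N2.
have h1 := NP1 n (leq_maxl _ _); have := NP2 n (leq_maxr _ _).
rewrite (sqr_sqrtr (ltW e'0)) => h2.
have -> : f - q = (f - v n) + (v n - q) by rewrite addrA subrK.
rewrite rdotDl//; [|exact: cB..].
apply: (le_trans (sqrD _ _)).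
have h3 := key n u Mu; have h4 := rdot_CauchySchwarz (cB (cv n) cq) cu.
have uu0 := rdot_ge0 cu.
have {}h3 : rdot (f - v n) u ^+ 2 <= c * (e / c / 4).
  by apply/(le_trans h3)/(ler_pM uu0 _ _ (ltW h1)); rewrite ?invr_ge0 ?lerDl.
have {}h4 : rdot (v n - q) u ^+ 2 <= c * (e / c / 4).
  apply: (le_trans h4); rewrite mulrC.
  by apply: (ler_pM uu0 (rdot_ge0 (cB _ _)) _ (ltW h2)) => //; rewrite lerDl.
have ce : c * (e / c / 4) = e / 4 by field; rewrite gt_eqF.
by move: h3 h4; rewrite ce; lra.
Qed.

Lemma sub_rkhs_closure M : M `<=` carrier -> M `<=` rkhs_closure H M.
Proof.
move=> Mc f Mf; have cf := Mc _ Mf; split=> // e e0; exists f => //.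
rewrite rkhs_norm_lt//; last exact: cB.
by rewrite subrr -[rdot _ _]/(repart _) (dot0l (carrier0 H)) repart0 exprn_gt0.
Qed.

(** Replacing [g] by [g - v] with [v] in [M] leaves the product with [f] unchanged, while
    Cauchy-Schwarz makes it arbitrarily small. *)
Lemma closure_dot_eq0 M f : carrier f -> M `<=` carrier ->
  (forall v, M v -> dot f v = 0) ->
  forall g, rkhs_closure H M g -> rdot f g = 0.
Proof.
move=> cf Mc fM g [cg gcl].
apply/eqP; rewrite -sqrf_eq0 eq_le sqr_ge0 andbT.
apply/ler_addgt0Pl => e e0; rewrite addr0.
pose c := rdot f f + 1; have c0 : 0 < c by rewrite ltr_wpDl// rdot_ge0.
have e'0 : 0 < Num.sqrt (e / c) by rewrite sqrtr_gt0 divr_gt0.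
have [v Mv] := gcl _ e'0; have cv := Mc _ Mv.
rewrite rkhs_norm_lt//; last exact: cB.
rewrite (sqr_sqrtr (ltW (divr_gt0 e0 c0))) => gv.
have -> : rdot f g = rdot f (g - v).
  by rewrite rdotBr// -[rdot f v]/(repart (dot f v)) fM// repart0 subr0.
apply: (le_trans (rdot_CauchySchwarz cf (cB cg cv))).
have -> : e = c * (e / c) by field; rewrite gt_eqF.
apply: ler_pM (ltW gv); rewrite ?rdot_ge0 ?lerDl//; exact: cB.
Qed.

(** Riesz representation of evaluation at [x], which shows that the [xget] in [kernel_at] never
    returns its default. *)
Lemma kernel_atP x :
  carrier (kernel_at H x) /\ forall f, carrier f -> f x = dot f (kernel_at H x).
Proof.
pose P := [set k | carrier k /\ forall f, carrier f -> f x = dot f k].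
suff: exists k, P k by case=> k; exact: xgetI.
have sC := subspace_carrier H.
pose M := [set f | carrier f /\ f x = 0].
have sM : subspace H M.
  split=> [f []//||a f g [cf fx] [cg gx]]; first by split; [exact: carrier0|].
  split; first exact: carrier_linear.
  by rewrite -[LHS]/(a * f x + g x) fx gx mulr0 addr0.
have [[f0 cf0 f0x]|noM] := pselect (exists2 f, carrier f & f x != 0); last first.
  exists 0; split; first exact: carrier0.
  move=> f cf; rewrite dot_conj//; last exact: carrier0.
  rewrite dot0l// conjugate0; apply/eqP/negP => /negP fx.
  by apply: noM; exists f.
(* The kernel at [x] is a multiple of the component of [f0] orthogonal to the
   functions vanishing at [x]. *)
have [q [cq qcl] qo] := projection_closure sM cf0.
(* Boundedness of evaluation makes its null space [M] closed. The constant [c] exceeds the bound [B]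
   and is positive, so it can be divided by. *)
have qx : q x = 0.
  have [B BP] := evaluation_bounded H x.
  apply: normr_le_ofreal_eq0 => e e0.
  pose c := `|B| + 1; have c0 : 0 < c by rewrite ltr_wpDl.
  have [v [cv vx] vq] := qcl _ (divr_gt0 e0 c0).
  have := BP _ (cB cq cv); rewrite -[(q - v) x]/(q x - v x) vx subr0 => /le_trans; apply.
  rewrite ler_ofreal (le_trans (y := c * (e / c)))//.
    apply: (@le_trans _ _ (c * rkhs_norm H (q - v))).
      by rewrite ler_wpM2r ?sqrtr_ge0// (le_trans (ler_norm _))// lerDl.
    by rewrite ler_wpM2l ?ltW.
  by rewrite mulrC divfK// gt_eqF.
pose n := f0 - q; have cn : carrier n by exact: cB.
have nx : n x != 0 by rewrite -[n x]/(f0 x - q x) qx subr0.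
have nn0 : dot n n != 0.
  apply: contra nx => /eqP /(dot_eq0 cn) ->; exact: eqxx.
(* The scalar is forced by the reproducing identity at [f = n]. *)
pose k := conjugate (n x / dot n n) *: n.
have ck : carrier k by exact: (subspaceZ _ sC).
exists k; split=> // f cf; rewrite dotZr// conjugateK.
(* Removing the right multiple of [n] makes [f] vanish at [x], so what remains is orthogonal to [n];
   this computes [dot f n]. *)
have : M (f - (f x / n x) *: n).
  split; first by apply: cB => //; exact: (subspaceZ _ sC).
  rewrite -[LHS]/(f x - f x / n x * n x).
  by rewrite divfK// subrr.
move=> Mfn; have cfn := Mfn.1; have /(congr1 (@conjugate R s)) := qo _ Mfn.
rewrite -/n -dot_conj// conjugate0 dotBl//; last exact: (subspaceZ _ sC).
rewrite dotZl// => /eqP; rewrite subr_eq0 => /eqP ->.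
(* [field] diverges when run directly on [scalar_field R s]. *)
have cancel (K : fieldType) (a b c : K) :
    a != 0 -> b != 0 -> c = a / b * (c / a * b).
  by move=> a0 b0; field; rewrite a0.
exact: cancel.
Qed.

End projection.

(** * Linear spans and projection without limits in finite dimension *)

Lemma lin_span_seq (K : pzRingType) (V : lmodType K) (r : seq V) (v : V) :
  lin_span [set` r] v ->
  exists a : 'I_(size r) -> K, v = \sum_(j < size r) a j *: r`_j.
Proof.
move=> [n [a [w [wr ->]]]].
elim: n a w wr => [|n IH] a w wr.
  exists (fun=> 0); rewrite big_ord0 big1// => j _; exact: scale0r.
have [c cE] := IH (fun i => a (widen_ord (leqnSn n) i)) _
  (fun i => wr (widen_ord (leqnSn n) i)).
(* The coefficient of the last vector is added at that vector's first position in [r], so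
   repetitions among the [w i] or in [r] are harmless. *)
have wrn : (index (w ord_max) r < size r)%N by rewrite index_mem; exact: wr.
exists (fun j => c j + (if j == Ordinal wrn then a ord_max else 0)).
rewrite big_ord_recr /= [X in X + _]cE.
under [in RHS]eq_bigr do rewrite scalerDl.
rewrite big_split /=; congr (_ + _).
rewrite (bigD1 (Ordinal wrn))//= eqxx nth_index; last exact: wr.
by rewrite big1 ?addr0// => j /negbTE ->; rewrite scale0r.
Qed.

Lemma sub_lin_span (K : pzRingType) (V : lmodType K) (A : set V) :
  A `<=` lin_span A.
Proof.
move=> v Av; exists 1%N, (fun=> 1), (fun=> v); split=> //.
by rewrite big_ord_recl big_ord0 addr0 scale1r.
Qed.

Section finite_projection.
Context (R : realType) (s : scalar_kind) (X : Type) (H : rkhs R s X).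
Local Notation F := (scalar_field R s).
Local Notation E := (X -> F).
Local Notation carrier := (carrier H).
Local Notation dot := (dot H).
Local Notation rdot := (rdot H).
Implicit Types (f g h u v : E) (M A B : set E).

Lemma lin_span_subspace A : A `<=` carrier -> subspace H (lin_span A).
Proof.
move=> Ac; split.
- move=> _ [n [a [w [Aw ->]]]]; apply: subspace_sum (subspace_carrier H) _ => i.
  exact/(subspaceZ _ (subspace_carrier H))/Ac.
- by exists 0%N, (fun=> 0), (fun=> 0); rewrite big_ord0; split=> // -[].
- move=> c _ _ [m [a [w [Aw ->]]]] [n [b [z [Az ->]]]].
  exists (m + n)%N, (fun i : 'I_(m + n) => match fintype.split i with
    | inl j => c * a j | inr k => b k end),
    (fun i : 'I_(m + n) => match fintype.split i with inl j => w j | inr k => z k end).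
  split=> [i|]; first by case: splitP.
  rewrite big_split_ord scaler_sumr; congr (_ + _); apply: eq_bigr => i _.
    by rewrite (unsplitK (inl i)) scalerA.
  by rewrite (unsplitK (inr i)).
Qed.

(** The vectors are nonzero but not normalized, which avoids square roots in the scalar field. *)
Definition orthogonal_family n (w : 'I_n -> E) :=
  [/\ forall i, carrier (w i), forall i, dot (w i) (w i) != 0
    & forall i j, i != j -> dot (w i) (w j) = 0].

Lemma dot_orthogonal_sum n (w : 'I_n -> E) (a : 'I_n -> F) j :
  orthogonal_family w ->
  dot (\sum_(i < n) a i *: w i) (w j) = a j * dot (w j) (w j).
Proof.
move=> [cw _ wo]; rewrite dot_suml// => [|i]; last first.
  exact/(subspaceZ _ (subspace_carrier H)).
rewrite (bigD1 j)//= dotZl// big1 ?addr0// => i ij.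
by rewrite dotZl// wo// mulr0.
Qed.

(** If [n] exceeded [size r], the coefficient matrix would have a nonzero row vector in its left
    kernel, hence a nontrivial vanishing combination of the [w i]; pairing with each [w i] kills its
    coefficients. *)
Lemma orthogonal_family_size n (w : 'I_n -> E) (r : seq E) :
  orthogonal_family w -> (forall i, lin_span [set` r] (w i)) -> (n <= size r)%N.
Proof.
move=> wo wr; rewrite leqNgt; apply/negP => rn.
have /choice[a aE] i := lin_span_seq (wr i).
pose A : 'M[F]_(n, size r) := \matrix_(i, j) a i j.
have : kermx A != 0.
  by rewrite -mxrank_eq0 mxrank_ker subn_eq0 -ltnNge (leq_ltn_trans (rank_leq_col _)).
move=> /rowV0Pn[u /sub_kermxP uA u0].
have uw : \sum_(i < n) u 0 i *: w i = 0.
  under eq_bigr do rewrite aE scaler_sumr.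
  rewrite exchange_big big1//= => j _.
  under eq_bigr do rewrite scalerA.
  rewrite -scaler_suml.
  have h : \sum_(i < n) u 0 i * a i j = 0.
    have /matrixP/(_ 0 j) := uA; rewrite !mxE => uAj; rewrite -[RHS]uAj.
    by apply: eq_bigr => i _; rewrite mxE.
  by rewrite h scale0r.
move/eqP : u0; apply; apply/rowP => i; rewrite mxE.
have := dot_orthogonal_sum (u 0) i wo; have [cw w0 _] := wo.
by rewrite uw dot0l// => /esym/eqP; rewrite mulf_eq0 (negbTE (w0 i)) orbF => /eqP.
Qed.

(** The projection is a finite Fourier sum over an orthogonal family in [M], so it lies in [M]
    itself and not merely in the closure. *)
Lemma projection_finite_span M B f : subspace H M -> finite_set B ->
  M `<=` lin_span B -> carrier f ->
  exists2 q, M q & forall v, M v -> dot (f - q) v = 0.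
Proof.
move=> sM /finite_seqP[r ->] Mr cf; have [Mc M0 _] := sM.
have sC := subspace_carrier H.
pose P n := `[< exists w : 'I_n -> E, orthogonal_family w /\ forall i, M (w i) >].
(* An orthogonal family in [M] of maximal size spans [M]. *)
have exP : exists n, P n.
  by exists 0%N; apply/asboolP; exists (fun=> 0); split; [split|]; case.
have ubP n : P n -> (n <= size r)%N.
  by move=> /asboolP[w [wo Mw]]; apply: (orthogonal_family_size wo) => i; exact: (Mr _ (Mw i)).
have [n /asboolP[w [wo Mw]] nmax] := ex_maxnP exP ubP.
have [cw w0 wD] := wo.
pose proj g := \sum_(i < n) (dot g (w i) / dot (w i) (w i)) *: w i.
have Mproj g : M (proj g).
  by apply: (subspace_sum _ sM) => i; exact: (subspaceZ _ sM).
have projP g i : carrier g -> dot (g - proj g) (w i) = 0.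
  move=> cg; rewrite dotBl//; last exact: Mc.
  by rewrite dot_orthogonal_sum// divfK// subrr.
(* Otherwise the residual [v] is a nonzero vector of [M] orthogonal to every [w i], and putting it
   in front of the family contradicts maximality. *)
have projM g : M g -> g = proj g.
  move=> Mg; have cg := Mc _ Mg; apply/eqP; rewrite -subr_eq0; apply/eqP.
  set v := g - proj g; have Mv : M v by exact: (subspaceB sM).
  have cv := Mc _ Mv; apply: (dot_eq0 cv); apply/eqP/negP => /negP v0.
  suff : P n.+1 by move=> /nmax; rewrite ltnn.
  apply/asboolP; exists (fun i => if unlift ord0 i is Some j then w j else v).
  split; last by move=> i; case: unliftP.
  split=> [i|i|i j]; [by case: unliftP|by case: unliftP|].
  case: unliftP => [k|] ->; case: unliftP => [l|] -> //.
  - by rewrite (inj_eq lift_inj) => kl; exact: wD.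
  - by move=> _; rewrite dot_conj// projP// conjugate0.
  - by move=> _; exact: projP.
exists (proj f) => // v Mv; have cv := Mc _ Mv.
have cfp : carrier (f - proj f) by apply: (subspaceB sC) => //; exact: Mc.
rewrite dot_conj// (projM v Mv) dot_suml// => [|i]; last exact: (subspaceZ _ sC).
rewrite big1 ?conjugate0// => i _.
by rewrite dotZl// (dot_conj cfp (cw i)) projP// conjugate0 mulr0.
Qed.

End finite_projection.

(** * Integrals of nonnegative functions that agree off a null set *)

Section almost_everywhere.
Context d (T : measurableType d) (R : realType).
Variable mu : {measure set T -> \bar R}.
Local Open Scope ereal_scope.
Import HBNNSimple.

(** Stated for arbitrary nonnegative functions: the integral is a supremum over simple functions
    below the integrand, and the comparison is made there. *)
Lemma ge0_integral_eq_off_null (N : set T) (f g : T -> \bar R) :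
  measurable N -> mu N = 0 -> (forall x, 0 <= f x) -> (forall x, 0 <= g x) ->
  (forall x, ~ N x -> f x = g x) -> \int[mu]_x f x = \int[mu]_x g x.
Proof.
move=> mN N0.
suff le_int (f1 f2 : T -> \bar R) : (forall x, 0 <= f1 x) ->
    (forall x, 0 <= f2 x) -> (forall x, ~ N x -> f1 x = f2 x) ->
    \int[mu]_x f1 x <= \int[mu]_x f2 x.
  move=> f0 g0 fg; apply/eqP; rewrite eq_le; apply/andP; split.
    exact: le_int.
  by apply: le_int => // x Nx; rewrite fg.
move=> f0 g0 fg; rewrite !ge0_integralTE//.
apply: ge_ereal_sup => _ [h/= hf <-]; apply: ereal_sup_ubound.
(* A simple function below [f1], set to zero on [N], lies below [f2] and has the
   same integral. *)
pose h' := proj_nnsfun h (measurableC mN).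
exists h' => /=.
  move=> x; rewrite /= measurable_realfun.mindicE; have [xN|xN] := pselect (N x).
    by rewrite memNset ?mulr0//= => /(_ xN).
  by rewrite mem_set// mulr1 -fg//; exact: hf.
rewrite -!integralT_nnsfun; apply: ge0_ae_eq_integral => //.
- exact/measurable_realfun.measurable_EFinP.
- exact/measurable_realfun.measurable_EFinP.
- by move=> x _; rewrite lee_fin.
- by move=> x _; rewrite lee_fin.
exists N; split=> // x /=; apply: contra_notP => xN _.
by rewrite measurable_realfun.mindicE mem_set// mulr1.
Qed.

End almost_everywhere.

(** * The complement of the support is null on a Polish space *)

Section support.
Context (R : realType) (X : ptopologicalType).
Variable mu : {measure set (borel X) -> \bar R}.

Lemma setC_supportP x : (~` measure_support mu) x ->
  exists U : set X, [/\ open U, U x & mu U = 0%E].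
Proof.
move=> xS; apply: contrapT => noU; apply: xS => U Uo Ux.
rewrite lt_neqAle measure_ge0 andbT; apply/eqP => U0.
by apply: noU; exists U.
Qed.

Lemma open_setC_support : open (~` measure_support mu).
Proof.
rewrite openE => x /setC_supportP[U [Uo Ux U0]].
rewrite /interior /= nbhsE; exists U => // y Uy /(_ U Uo Uy).
by rewrite U0 ltxx.
Qed.

Lemma measurable_open (U : set X) : open U -> measurable (U : set (borel X)).
Proof. by move=> Uo; exact: sub_sigma_algebra. Qed.

(** Balls of radius [n.+1%:R^-1] around a dense sequence form a countable family; the null ones
    among them already cover the complement of the support. *)
Lemma measure_setC_support : polish R X -> mu (~` measure_support mu) = 0%E.
Proof.
move=> [[D /pcard_surjP[e eD] Dd] [d [[d0 dE dC dT] dnbhs _]]].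
pose V x n := [set y | d x y < n.+1%:R^-1].
have Vo x n : open (V x n).
  rewrite openE => y /= Vy; apply/dnbhs.
  exists (n.+1%:R^-1 - d x y); first by rewrite subr_gt0.
  by move=> z /= yz; rewrite /V/= (le_lt_trans (dT x y z))// -ltrBrDl.
(* Balls of positive measure are replaced by the empty set, so that the union can run over all pairs
   [a], [n]. *)
pose W a n := if mu (V (e a) n) == 0%E then V (e a) n else set0.
have sW : ~` measure_support mu `<=` \bigcup_a \bigcup_n W a n.
  move=> x /setC_supportP[U [Uo Ux U0]].
  have /dnbhs[r r0 rU] : nbhs x U by exact: open_nbhs_nbhs.
  have r2 : 0 < r / 2 by rewrite divr_gt0.
  have /cvgrPdist_lt/(_ _ r2)[n _ /(_ n (leqnn n))] := @cvg_harmonic R.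
  rewrite /= sub0r normrN ger0_norm ?invr_ge0// => nr.
  (* The radius is below [r / 2], so the ball of that radius around a dense point [y] of [V x n]
     contains [x] and stays within distance [r] of [x]. It thus lies in the null set [U]. *)
  have [||y [/= xy /eD[a _ ay]]] := Dd (V x n); [|exact: Vo|].
    by exists x; rewrite /V/= (dE x x).2// invr_gt0.
  exists a => //; exists n => //; rewrite /W ifT; last first.
    rewrite eq_le measure_ge0 andbT -U0.
    apply: le_measure; rewrite ?inE; [exact: measurable_open..|].
    move=> z /= yz; apply: rU => /=; rewrite (le_lt_trans (dT x y z))//.
    by rewrite [r]splitr ltrD// (lt_trans _ nr)// -ay.
  by rewrite /V/= ay dC.
apply/(negligibleP _ (measurable_open open_setC_support)).
apply: (@negligibleS _ (borel X) R mu _ _ sW); apply: negligible_bigcup => a.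
apply: negligible_bigcup => n; rewrite /W; case: ifPn => [/eqP V0|_].
  exact/(negligibleP _ (measurable_open (Vo _ _))).
exact: negligible_set0.
Qed.

End support.

(** * Comparing the optimizer with its projection *)

Section representer.
Context (R : realType) (s : scalar_kind) (X : ptopologicalType).
Context (H : rkhs R s X) (mu : probability (borel X) R) (p lambda : R).
Context (g : X -> scalar_field R s).
Context (c : scalar_field R s * scalar_field R s -> R).
Local Notation carrier := (carrier H).
Local Notation dot := (dot H).
Local Notation M := (lin_span (kernel_at H @` measure_support mu)).
Hypotheses (X_polish : polish R X) (p_gt0 : 0 < p) (lambda_gt0 : 0 < lambda).
Hypothesis c_ge0 : forall w, 0 <= c w.
Hypothesis c0_L1 : mu.-integrable [set: borel X] (fun x => (c (0, g x))%:E).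

Let kernels_sub : kernel_at H @` measure_support mu `<=` carrier.
Proof. by move=> _ [x _ <-]; have [] := kernel_atP H x. Qed.

Lemma kernel_span_subspace : subspace H M.
Proof. exact: lin_span_subspace. Qed.

(** Serves both conclusions of the theorem, with [q] obtained either from the limit projection or
    from the finite one. *)
Lemma optimizer_eq_projection fhat q : optimizer H mu p lambda g c fhat ->
  rkhs_closure H M q -> (forall v, M v -> dot (fhat - q) v = 0) -> fhat = q.
Proof.
move=> [cf fmin] qM orth; have [cq _] := qM.
have sC := subspace_carrier H; have [Mc _ _] := kernel_span_subspace.
have cn : carrier (fhat - q) by exact: (subspaceB sC).
have fq x : measure_support mu x -> fhat x = q x.
  move=> Sx; have [_ kx] := kernel_atP H x.
  apply/eqP; rewrite -subr_eq0 -[_ - _]/((fhat - q) x) kx// orth//.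
  by apply: sub_lin_span; exists x.
pose J (f : X -> scalar_field R s) : \bar R :=
  (\int[mu]_(x in [set: borel X]) (c (f x, g x))%:E)%E.
have Jq : J fhat = J q.
  apply: (ge0_integral_eq_off_null
    (measurable_open (open_setC_support mu)) (measure_setC_support mu X_polish)).
  - by move=> x; rewrite lee_fin.
  - by move=> x; rewrite lee_fin.
  - by move=> x /contrapT Sx; rewrite fq.
have J_ge0 f : (0 <= J f)%E by apply: integral_ge0 => x _; rewrite lee_fin.
have J0_fin : (J 0%R < +oo)%E.
  have /integrableP[_] := c0_L1; under eq_integral do rewrite gee0_abs ?lee_fin//.
  exact.
(* Optimality against the zero function bounds the cost of [fhat]. Finiteness is what allows the
   common integral to be cancelled when [fhat] is compared with [q]. *)
have J_fin : J fhat \is a fin_num.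
  rewrite ge0_fin_numE//; have := fmin _ (carrier0 H).
  rewrite /objective -/(J fhat) -/(J 0) => h.
  apply: le_lt_trans (lte_add_pinfty J0_fin (ltry _)).
  apply: le_trans h; rewrite leeDl// lee_fin mulr_ge0 ?powR_ge0//.
  exact: ltW.
have := fmin _ cq; rewrite /objective -/(J fhat) -/(J q) -Jq leeD2lE// lee_fin.
rewrite ler_pM2l// => norm_le.
have nq : rdot H (fhat - q) q = 0 := closure_dot_eq0 cn Mc orth qM.
have norm_split : rdot H fhat fhat = rdot H (fhat - q) (fhat - q) + rdot H q q.
  by rewrite -rdot_Pythagoras// subrK.
apply/eqP; rewrite -subr_eq0; apply/eqP/(rdot_eq0 cn)/eqP.
rewrite eq_le rdot_ge0// andbT leNgt; apply/negP => n_gt0.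
move: norm_le; apply/negP; rewrite -ltNge; apply: gt0_ltr_powR => //.
- by rewrite nnegrE sqrtr_ge0.
- by rewrite nnegrE sqrtr_ge0.
rewrite ltr_sqrt; last by rewrite -/(rdot H _ _) norm_split ltr_wpDr// rdot_ge0.
by rewrite -![repart _]/(rdot H _ _) norm_split ltrDr.
Qed.

End representer.

Theorem corollary3p3 (R : realType) (s : scalar_kind) (X : ptopologicalType)
    (H : rkhs R s X) (mu : probability (borel X) R) (p lambda : R)
    (g : X -> scalar_field R s) (c : scalar_field R s * scalar_field R s -> R)
    (fhat : X -> scalar_field R s)
    (X_polish : polish R X)
    (H_borel : forall f, carrier H f -> borel_fun f)
    (p_gt1 : 1 < p) (lambda_gt0 : 0 < lambda)
    (g_borel : borel_fun g) (c_borel : borel_fun c)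
    (c_ge0 : forall w, 0 <= c w)
    (c0_L1 : mu.-integrable [set: borel X] (fun x => (c (0, g x))%:E))
    (c_lsc : forall z, lower_semicontinuous (fun w => (c (w, z))%:E))
    (c_convex : forall z, convex_on_scalars (fun w => c (w, z)))
    (fhat_opt : optimizer H mu p lambda g c fhat) :
  rkhs_closure H (lin_span (kernel_at H @` measure_support mu)) fhat /\
  (finite_set (measure_support mu) \/ finite_dimensional H ->
   lin_span (kernel_at H @` measure_support mu) fhat).
Proof.
have p_gt0 := lt_trans ltr01 p_gt1.
have [cf _] := fhat_opt.
have sM := kernel_span_subspace H mu.
have eq_proj q := @optimizer_eq_projection R s X H mu p lambda g c
  X_polish p_gt0 lambda_gt0 c_ge0 c0_L1 fhat q fhat_opt.
split.
  have [q qM orth] := projection_closure sM cf.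
  by rewrite (eq_proj q).
move=> fin.
(* Both alternatives reduce to a finite set spanning at least the kernel span: the kernels
   themselves, or a spanning set of the whole space. *)
have [B finB MB] : exists2 B, finite_set B &
    lin_span (kernel_at H @` measure_support mu) `<=` lin_span B.
  case: fin => [finS|[B [finB _ HB]]].
    by exists (kernel_at H @` measure_support mu) => //; exact: finite_image.
  by exists B => // f Mf; apply: HB; have [Mc _ _] := sM; exact: Mc.
have [q Mq orth] := projection_finite_span sM finB MB cf.
rewrite (eq_proj q)//; by apply: sub_rkhs_closure => //; case: sM.
Qed.
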